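(* (Adequacy.) Let $\mathcal R$ be a term rewrite system and $\mathcal G(\mathcal R)$ a simulating graph rewrite system of $\mathcal R$. Let $s$ be a term, let $p$ be a position, and let $S$ be a term graph with $\mathrm{term}(S)=s$. Then for every term $t$: $$ s \to_{\mathcal R,p} t \quad\text{if and only if}\quad S \;(\uparrow_p)^{!}\cdot(\downarrow_p)^{!}\cdot \Rightarrow_{\mathcal G(\mathcal R),p}\; T $$ for some term graph $T$ with $\mathrm{term}(T)=t$.
   Context: Fix a finite signature $\mathcal F$ containing a constant and a countably infinite set $\mathcal V$ of variables. A TRS $\mathcal R$ is a finite set of rules $l\to r$ with $l\notin\mathcal V$ and $\mathrm{Var}(r)\subseteq\mathrm{Var}(l)$; $s\to_{\mathcal R,p}t$ means $s$ rewrites to $t$ by a rule applied at position $p$ of $s$. A graph $G=(N_G,\mathrm{succ}_G,\mathrm{lab}_G)$ has a finite node set $N_G$, a map $\mathrm{succ}_G$ assigning to each node a finite sequence of nodes (if $v$ is the $i$-th entry of $\mathrm{succ}_G(u)$ write $u\xrightarrow{i}v$), and a labelling $\mathrm{lab}_G$. A term graph is a graph with labels in $\mathcal F\cup\mathcal V$ that is acyclic, rooted (there is a unique node $\mathrm{rt}(S)$ from which all nodes are reachable), in which a node labelled by a $k$-ary $f\in\mathcal F$ has exactly $k$ successors, a node labelled by a variable has no successors, and two nodes carrying the same variable label are equal. $S|_u$ is the term graph of nodes reachable from $u$. The represented term: $\mathrm{term}(S)=x$ if the root is labelled $x\in\mathcal V$, and $\mathrm{term}(S)=f(\mathrm{term}(S|_{u_1}),\dots,\mathrm{term}(S|_{u_k}))$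 if the root is labelled $f$ with successors $[u_1,\dots,u_k]$. $\mathrm{Var}(S)$ is the set of variable-labelled nodes. Positions: $\mathrm{Pos}_S(u)$ is $\{\varepsilon\}$ if $u=\mathrm{rt}(S)$ and otherwise the set of sequences $i_1\cdots i_k$ with $\mathrm{rt}(S)\xrightarrow{i_1}\cdots\xrightarrow{i_k}u$; $u$ corresponds to $p$ if $p\in\mathrm{Pos}_S(u)$ (each position of $S$ corresponds to exactly one node). $p\le q$ means $p$ is a prefix of $q$; $p<q$ a proper prefix. A node is unshared if $\mathrm{Pos}_S(u)$ is a singleton. A node is strictly below $p$ if it corresponds to some $q$ with $p<q$. $\mathrm{Tree}(s)$ is the set of term graphs representing $s$ in which every non-variable node is unshared. Morphism $m\colon L\to T$: a map $N_L\to N_T$ with $m(\mathrm{rt}(L))=\mathrm{rt}(T)$ and, for every $u\in L$ with $\mathrm{lab}_L(u)\in\mathcal F$, $\mathrm{lab}_T(m(u))=\mathrm{lab}_L(u)$ and $\mathrm{succ}_T(m(u))=m^*(\mathrm{succ}_L(u))$ ($m^*$ applied entrywise). $S\geq_m T$ means $m\colon S\to T$ is a morphism and these two conditions hold for all nodes of $S$. Replacement: for $u\in S$ and a rooted graph $H$ sharing nodes properly with $S$ (common nodes have equal labels and successors), $S[H]_u$ is obtained by redirecting every successor edge pointing to $u$ to $\mathrm{rt}(H)$, removing $u$, taking the union with $H$, and restricting to nodes reachable from $\mathrm{rt}(H)$ if $u=\mathrm{rt}(S)$ and from $\mathrm{rt}(S)$ otherwise. A graph rewrite rule $L\to R$ is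 a pair of properly sharing term graphs with $\mathrm{rt}(L)\notin\mathrm{Var}(L)$, $\mathrm{Var}(R)\subseteq\mathrm{Var}(L)$, $\mathrm{rt}(L)\notin R$. A simulating GRS $\mathcal G(\mathcal R)$ contains for each $l\to r\in\mathcal R$ a rule $L\to R$ with $L\in\mathrm{Tree}(l)$, $R\in\mathrm{Tree}(r)$ and $N_L\cap N_R=\mathrm{Var}(R)$. $S\Rightarrow_{\mathcal G,p}T$ holds if, for the node $u$ corresponding to $p$, some rule of $\mathcal G$ has an isomorphic copy $L'\to R'$ with nodes disjoint from $S$ and a morphism $m\colon L'\to S|_u$ such that $T=S[m(R')]_u$, where $m(R')$ is $R'$ with every node $v$ in the domain of $m$ replaced by $m(v)$ (carrying its label and successors from $S$). Collapsing: fix a strict total order $\succ$ on nodes. For nodes $u\succ v$ of $S$, $S\rhd_{u\mapsto v}T$ means $T$ is a term graph and $S\geq_m T$ for the map $m(u)=v$, $m(w)=w$ for $w\neq u$. Fold: $S\downarrow_p T$ if $S\rhd_{u\mapsto v}T$ for some nodes $u,v$ strictly below $p$ in $S$. Unfold: $S\uparrow_p T$ if $T\rhd_{u\mapsto v}S$ for some node $u$ of $T$ with $\mathrm{Pos}_T(u)=\{q\}$ and $q\le p$. For a relation $\to$, $S\to^{!}T$ means $S\to^*T$ and no $T'$ with $T\to T'$ exists; $\cdot$ denotes relational composition.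
   Formalization: The fixed strict total order on nodes is assumed to have no greatest node; otherwise a shared greatest node could never be unfolded and the claim fails, e.g. for the rule a → b and S = f(v,v) with v the greatest node, labelled a. *)

(* Defs.v *)
(* MathComp world: finmap supplies finite maps; boolp makes reachability a
   boolean by excluded middle. *)
From Stdlib Require List.
From Stdlib Require Import Relation_Operators.
From mathcomp Require Import all_boot all_order finmap boolp.

Set Implicit Arguments.
Unset Strict Implicit.
Unset Printing Implicit Defensive.

Local Open Scope fset_scope.
Local Open Scope fmap_scope.

(* Positions are sequences of argument indices, counted from 0. *)
Definition position := seq nat.

Definition proper_prefix (p q : position) : bool := prefix p q && (p != q).

Definition normalizes (A : Type) (E : A -> A -> Prop) (a b : A) : Prop :=
  clos_refl_trans A E a b /\ ~ exists c, E b c.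

Definition rel_comp (A : Type) (E E' : A -> A -> Prop) (a c : A) : Prop :=
  exists b, E a b /\ E' b c.

Section Terms.
Variables (F : finType) (ar : F -> nat) (V : countType).

Inductive term : Type :=
| TVar of V
| TApp (f : F) of {ffun 'I_(ar f) -> term}.

Fixpoint in_vars (x : V) (t : term) : Prop :=
  match t with
  | TVar y => y = x
  | TApp f ts => exists i, in_vars x (ts i)
  end.

Fixpoint subst (sigma : V -> term) (t : term) : term :=
  match t with
  | TVar x => sigma x
  | TApp f ts => TApp [ffun i => subst sigma (ts i)]
  end.

Fixpoint subterm_at (t : term) (p : position) : option term :=
  match p, t with
  | [::], _ => Some t
  | _ :: _, TVar _ => None
  | i :: p', TApp f ts =>
      if insub i is Some j then subterm_at (ts j) p' else None
  end.

(* Meaningful only when p is a position of t. *)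
Fixpoint replace_at (t : term) (p : position) (u : term) : term :=
  match p, t with
  | [::], _ => u
  | _ :: _, TVar _ => t
  | i :: p', TApp f ts =>
      TApp [ffun j => if val j == i then replace_at (ts j) p' u else ts j]
  end.

Definition trs := seq (term * term).

Definition is_trs (Rs : trs) : Prop :=
  forall l r, List.In (l, r) Rs ->
    (forall x, l <> TVar x) /\ (forall x, in_vars x r -> in_vars x l).

Definition rewrites (Rs : trs) (p : position) (s t : term) : Prop :=
  exists l r sigma,
    [/\ List.In (l, r) Rs,
        subterm_at s p = Some (subst sigma l)
      & t = replace_at s p (subst sigma r)].

End Terms.

Section TermGraphs.
Variables (F : finType) (ar : F -> nat) (V : countType).
Variables (disp : Order.disp_t) (N : orderType disp).

(* The domain of the finite map is the node set; each node is sent to its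
   label and its successor sequence. *)
Definition graph := {fmap N -> (F + V) * seq N}.

Record rooted_graph := RootedGraph { gr :> graph; rt : N }.

Definition nodes (G : graph) : {fset N} := domf G.

Definition lab (G : graph) (u : N) : option (F + V) := omap fst G.[? u].

Definition succ (G : graph) (u : N) : seq N := oapp snd [::] G.[? u].

Definition edge (G : graph) (u : N) (i : nat) (v : N) : Prop :=
  onth (succ G u) i = Some v.

Fixpoint walk (G : graph) (u : N) (p : position) (v : N) : Prop :=
  match p with
  | [::] => u = v
  | i :: p' => exists w, edge G u i w /\ walk G w p' v
  end.

Definition reach (G : graph) (u v : N) : Prop := exists p, walk G u p v.

Definition is_root (G : graph) (r : N) : Prop :=
  r \in nodes G /\ forall u, u \in nodes G -> reach G r u.

Record is_term_graph (S : rooted_graph) : Prop := IsTermGraph {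
  tg_closed : forall u v, u \in nodes S -> v \in succ S u -> v \in nodes S;
  tg_acyclic : forall u p, walk S u p u -> p = [::];
  tg_root : is_root S (rt S);
  tg_root_unique : forall r, is_root S r -> r = rt S;
  tg_fun : forall u f, lab S u = Some (inl f) -> size (succ S u) = ar f;
  tg_var : forall u x, lab S u = Some (inr x) -> succ S u = [::];
  tg_var_unique : forall u v x,
    lab S u = Some (inr x) -> lab S v = Some (inr x) -> u = v
}.

Definition var_node (G : graph) (u : N) : Prop :=
  exists x, lab G u = Some (inr x).

Definition subgraph (S : rooted_graph) (u : N) : rooted_graph :=
  RootedGraph (filterf (gr S) (fun v => `[< reach S u v >])) u.

(* [represents S t] is the graph of the partial function term(S). *)
Fixpoint represents (S : rooted_graph) (t : term ar V) : Prop :=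
  match t with
  | TVar x => lab S (rt S) = Some (inr x)
  | TApp f ts =>
      lab S (rt S) = Some (inl f) /\
      forall i : 'I_(ar f),
        exists v, edge S (rt S) i v /\ represents (subgraph S v) (ts i)
  end.

(* [pos S u p]: the node u corresponds to the position p in S. *)
Definition pos (S : rooted_graph) (u : N) (p : position) : Prop :=
  u \in nodes S /\ if u == rt S then p = [::] else walk S (rt S) p u.

Definition unshared_at (S : rooted_graph) (u : N) (q : position) : Prop :=
  forall q', pos S u q' <-> q' = q.

Definition unshared (S : rooted_graph) (u : N) : Prop :=
  exists q, unshared_at S u q.

Definition strictly_below (S : rooted_graph) (p : position) (u : N) : Prop :=
  exists q, pos S u q /\ proper_prefix p q.

Definition in_tree (S : rooted_graph) (t : term ar V) : Prop :=
  [/\ is_term_graph S, represents S t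
    & forall u, u \in nodes S -> ~ var_node S u -> unshared S u].

Definition preserves (S T : rooted_graph) (m : N -> N) (u : N) : Prop :=
  lab T (m u) = lab S u /\ succ T (m u) = map m (succ S u).

(* Only the values of m on the nodes of the source matter. *)
Definition morphism (m : N -> N) (L T : rooted_graph) : Prop :=
  [/\ forall u, u \in nodes L -> m u \in nodes T,
      m (rt L) = rt T
    & forall u f, lab L u = Some (inl f) -> preserves L T m u].

Definition gmorphism (m : N -> N) (S T : rooted_graph) : Prop :=
  morphism m S T /\ forall u, u \in nodes S -> preserves S T m u.

(* u \succ v in the strict total order on nodes is (v < u)%O. *)
Definition collapse (S : rooted_graph) (u v : N) (T : rooted_graph) : Prop :=
  [/\ is_term_graph S, is_term_graph T,
      u \in nodes S, v \in nodes S
    & (v < u)%O /\ gmorphism (fun w => if w == u then v else w) S T].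

Definition fold_step (p : position) (S T : rooted_graph) : Prop :=
  exists u v,
    [/\ strictly_below S p u, strictly_below S p v & collapse S u v T].

Definition unfold_step (p : position) (S T : rooted_graph) : Prop :=
  exists u v q, [/\ collapse T u v S, unshared_at T u q & prefix q p].

Definition map_succ (h : N -> N) (G : graph) : graph :=
  [fmap u : domf G => let: (l, us) := G.[valP u] in (l, map h us)].

(* S[H]_u.  In the union, H and the redirected S agree on common nodes whenever
   H shares properly with S and none of the common nodes points to u. *)
Definition replace_node (S : rooted_graph) (u : N) (H : rooted_graph) :
    rooted_graph :=
  let redirect v := if v == u then rt H else v in
  let r := redirect (rt S) in
  subgraph (RootedGraph (map_succ redirect (gr S).[~ u] + gr H) r) r.

(* m(R) for m : L -> S.  Successors in S of an image m v need not belong to the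
   result; they are supplied by S in replace_node. *)
Definition instantiate (L R : rooted_graph) (m : N -> N) (S : rooted_graph) :
    rooted_graph :=
  let mbar v := if v \in nodes L then m v else v in
  RootedGraph
    (map_succ mbar (gr R).[\ nodes L] + (gr S).[& m @` (nodes R `&` nodes L)])
    (mbar (rt R)).

Definition properly_sharing (G H : graph) : Prop :=
  forall u, u \in nodes G -> u \in nodes H ->
    lab G u = lab H u /\ succ G u = succ H u.

Definition grule := (rooted_graph * rooted_graph)%type.

Definition is_grule (g : grule) : Prop :=
  let: (L, R) := g in
  [/\ is_term_graph L, is_term_graph R, properly_sharing L R
    & [/\ ~ var_node L (rt L),
          forall u, var_node R u -> var_node L u
        & rt L \notin nodes R]].

Definition grs := seq grule.

Definition simulates_rule (lr : term ar V * term ar V) (g : grule) : Prop :=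
  let: (l, r) := lr in let: (L, R) := g in
  [/\ is_grule g, in_tree L l, in_tree R r
    & forall u, u \in nodes L `&` nodes R <-> var_node R u].

(* Gs simulates every rule of Rs and contains no other rules. *)
Definition simulating (Rs : trs ar V) (Gs : grs) : Prop :=
  (forall lr, List.In lr Rs -> exists g, List.In g Gs /\ simulates_rule lr g) /\
  (forall g, List.In g Gs -> exists lr, List.In lr Rs /\ simulates_rule lr g).

Definition renaming_of (rho : N -> N) (G G' : rooted_graph) : Prop :=
  [/\ nodes G' = rho @` nodes G, rt G' = rho (rt G)
    & forall u, u \in nodes G -> preserves G G' rho u].

Definition isomorphic_copy (g g' : grule) : Prop :=
  let: (L, R) := g in let: (L', R') := g' in
  exists rho : N -> N,
    [/\ {in nodes L `|` nodes R &, injective rho},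
        renaming_of rho L L' & renaming_of rho R R'].

Definition grewrites (Gs : grs) (p : position) (S T : rooted_graph) : Prop :=
  exists u g L' R' m,
    [/\ pos S u p,
        List.In g Gs /\ isomorphic_copy g (L', R'),
        [disjoint nodes L' `|` nodes R' & nodes S],
        morphism m L' (subgraph S u)
      & T = replace_node S u (instantiate L' R' m S)].

End TermGraphs.

(* Main.v *)
(** A rule with a nonlinear left-hand side matches at a node [u] as soon as any
    two nodes strictly below [u] representing the same term are equal, and
    overwriting [u] rewrites only position [p] as soon as [p] is the only
    position of [u].  Normal forms of unfolding have the second property: if the
    node [w] at a prefix [q.i] of [p] is shared but its parent is not, then
    redirecting the [i]-th edge of the parent to a fresh copy of [w] is an
    unfolding step.  Normal forms of folding have the first: by induction on the
    represented term, two such nodes have equal successors, so that if distinct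
    they could be collapsed.  Folding strictly below [p] does not touch the node
    at [p], so the first normalization survives the second.  Both normalizations
    terminate because collapsing removes a node, and the nodes of a term graph
    are at most as many as the positions of its term. *)

Require Import Defs.
From Stdlib Require Import Relation_Operators.
From Stdlib Require List Eqdep_dec.
From mathcomp Require Import all_boot all_order finmap boolp.

Set Implicit Arguments.
Unset Strict Implicit.
Unset Printing Implicit Defensive.

Import Order.TTheory.

Local Open Scope fset_scope.
Local Open Scope fmap_scope.

(** * Normal forms of an abstract relation under a decreasing measure *)

Lemma normalizes_exists (A : Type) (E : A -> A -> Prop) (I : A -> Prop)
    (mu : A -> nat) :
  (forall a b, I a -> E a b -> I b /\ (mu b < mu a)%N) ->
  forall a, I a -> exists b, normalizes E a b.
Proof.
move=> dec a; move: {2}(mu a).+1 (ltnSn (mu a)) => n.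
elim: n a => // n IHn a le_n Ia.
(* [E] is an arbitrary relation, so excluded middle decides whether [a] has a step. *)
have [[b Eab]|nf] := pselect (exists b, E a b); last first.
  by exists a; split=> //; apply: rt_refl.
have [Ib lt_ba] := dec a b Ia Eab.
have [c [bc nfc]] := IHn b (leq_trans lt_ba le_n) Ib.
by exists c; split=> //; apply: rt_trans bc; apply: rt_step.
Qed.

Lemma normalizes_inv (A : Type) (E : A -> A -> Prop) (I : A -> Prop) :
  (forall a b, I a -> E a b -> I b) ->
  forall a b, I a -> normalizes E a b -> I b.
Proof. by move=> pres a b + [ab _]; elim: ab => //; eauto. Qed.

(** * Terms, substitutions and positions *)

Section TermTheory.
Variables (F : finType) (ar : F -> nat) (V : countType).
Implicit Types (s t : term ar V) (p q : position).

(** The arguments sit inside a finite function, so the recursion is written by hand: the call on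
    [ts i] counts as structural. *)
Lemma nested_term_ind (P : term ar V -> Prop) :
  (forall x, P (TVar ar x)) ->
  (forall f (ts : {ffun 'I_(ar f) -> term ar V}),
     (forall i, P (ts i)) -> P (TApp ts)) ->
  forall t, P t.
Proof.
move=> Pvar Papp; fix IH 1; case=> [x|f ts]; first exact: Pvar.
by apply: Papp => i; apply: IH.
Qed.

(** Injectivity of the constructor only gives an equality of dependent pairs; decidable equality on
    [F] extracts the second components. *)
Lemma TApp_inj f (ts us : {ffun 'I_(ar f) -> term ar V}) :
  TApp ts = TApp us -> ts = us.
Proof.
by case=> e; apply: (Eqdep_dec.inj_pair2_eq_dec _ (@eq_comparable F) _ _ _ _ e).
Qed.

(** This transfers agreement of two substitutions from a left-hand side to the right-hand side,
    whose variables are among those of the left. *)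
Lemma subst_eq_in (sigma tau : V -> term ar V) t :
  subst sigma t = subst tau t <-> forall x, in_vars x t -> sigma x = tau x.
Proof.
elim/nested_term_ind: t => [y|f ts IH] /=.
  by split=> [e _ <- //|]; apply.
split=> [/TApp_inj/ffunP e x [i xi]|e].
  by have := e i; rewrite !ffunE => /IH; apply.
by congr TApp; apply/ffunP=> i; rewrite !ffunE; apply/IH => x xi; apply: e; exists i.
Qed.

(** The length of this list bounds the number of nodes of any term graph of [t], which makes
    unfolding terminate. *)
Fixpoint positions (t : term ar V) : seq position :=
  [::] :: (if t is TApp f ts then
             flatten [seq [seq (val i) :: q | q <- positions (ts i)]
                     | i <- enum 'I_(ar f)]
           else [::]).

Lemma mem_positions t p u : subterm_at t p = Some u -> p \in positions t.
Proof.
elim: p t => [|k p IHp] [x|f ts] //=.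
case: insubP => // i _ <- /IHp p_i; rewrite inE /=.
by apply/flattenP; exists [seq (val i) :: q | q <- positions (ts i)];
  [apply: map_f; rewrite mem_enum | apply: map_f].
Qed.

Lemma subterm_at_cat t p q :
  subterm_at t (p ++ q) = obind (fun u => subterm_at u q) (subterm_at t p).
Proof. by elim: p t => [|k p IHp] [x|f ts] //=; case: insubP. Qed.

Lemma subterm_at_subst sigma t p u : subterm_at t p = Some u ->
  subterm_at (subst sigma t) p = Some (subst sigma u).
Proof.
elim: p t => [|k p IHp] [x|f ts] //=.
- by case=> <- /=; case: (sigma x).
- by case=> <-.
- by case: insubP => // i _ _ /IHp; rewrite ffunE.
Qed.

(** If [t] recurs at [i :: p], then its [i]-th argument recurs in itself at [rcons p i], against the
    induction hypothesis. Acyclicity of graphs follows from this. *)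
Lemma subterm_at_self t p : subterm_at t p = Some t -> p = [::].
Proof.
elim/nested_term_ind: t p => [x|f ts IH] [|k p] //=.
case: insubP => // i _ _ e; have : subterm_at (ts i) (rcons p (val i)) = Some (ts i).
  by rewrite -cats1 subterm_at_cat e /= valK; case: (ts i).
by move/IH/(congr1 size); rewrite size_rcons.
Qed.

End TermTheory.

(** * Walks, represented terms and the conditions on term graphs *)

Section GraphTheory.
Variables (F : finType) (ar : F -> nat) (V : countType).
Variables (disp : Order.disp_t) (N : orderType disp).
Local Notation graph := (graph F V N).
Local Notation rooted_graph := (rooted_graph F V N).
Local Notation term := (term ar V).
Implicit Types (G : graph) (S T : rooted_graph) (t : term) (p q : position).
Implicit Types (u v w : N) (m : N -> N).

Lemma walk_cat G u p q v :
  walk G u (p ++ q) v <-> exists w, walk G u p w /\ walk G w q v.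
Proof.
elim: p u => [|i p IH] u /=; first by split=> [|[w [<-]]] //; exists u.
split=> [[w [e /IH[x [wx xv]]]]|[x [[w [e wx]] xv]]].
  by exists x; split=> //; exists w.
by exists w; split=> //; apply/IH; exists x.
Qed.

Lemma walk_det G u p v w : walk G u p v -> walk G u p w -> v = w.
Proof.
elim: p u => [|i p IH] u /=; first by move=> <- <-.
by move=> [x [e xv]] [y [e' yw]]; move: e e' yw; rewrite /edge => -> [<-]; apply: IH.
Qed.

Lemma walk_rcons G u p i v :
  walk G u (rcons p i) v <-> exists w, walk G u p w /\ edge G w i v.
Proof.
rewrite -cats1 walk_cat; split=> -[w [uw wv]]; exists w; split=> //.
  by case: wv => x [e <-].
by exists v.
Qed.

Lemma reach_refl G u : reach G u u. Proof. by exists [::]. Qed.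

Lemma reach_trans G u v w : reach G u v -> reach G v w -> reach G u w.
Proof. by move=> [p uv] [q vw]; exists (p ++ q); apply/walk_cat; exists v. Qed.

Lemma edge_reach G u i v : edge G u i v -> reach G u v.
Proof. by exists [:: i], v. Qed.

Lemma edge_mem G u i v : edge G u i v -> v \in succ G u.
Proof. by move=> e; apply/onthP; exists i. Qed.

Lemma edge_nodes G u i v : edge G u i v -> u \in nodes G.
Proof. by rewrite /edge /succ; case: fndP => //; rewrite /= onth0n. Qed.

Lemma lab_nodes G u a : lab G u = Some a -> u \in nodes G.
Proof. by rewrite /lab; case: fndP. Qed.

Lemma nodes_lab G u : u \in nodes G -> exists a, lab G u = Some a.
Proof. by rewrite /lab; case: fndP => // uG _; eexists. Qed.

(** The local conditions on a term graph are kept apart because they suffice to relate walks to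
    positions, before acyclicity or rootedness is known. *)
Definition wf_labels G : Prop :=
  (forall u f, lab G u = Some (inl f) -> size (succ G u) = ar f) /\
  (forall u x, lab G u = Some (inr x) -> succ G u = [::]).

(* [represents] by the node [u], evaluated in [G] itself rather than in
   iterated subgraphs. *)
Fixpoint rep G u (t : term) : Prop :=
  match t with
  | TVar x => lab G u = Some (inr x)
  | TApp f ts => lab G u = Some (inl f) /\
      forall i : 'I_(ar f), exists v, edge G u i v /\ rep G v (ts i)
  end.

Lemma rep_nodes G u t : rep G u t -> u \in nodes G.
Proof. by case: t => [x|f ts] /= => [|[]] /lab_nodes. Qed.

Lemma rep_uniq G u t t' : rep G u t -> rep G u t' -> t = t'.
Proof.
elim/nested_term_ind: t u t' => [x|f ts IH] u [y|g us] /=.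
- by move=> -> [->].
- by move=> -> [].
- by case=> ->.
(* The equality of labels is eliminated while [g] is a variable, so that both argument functions get
   the same type. *)
- case=> -> ets [[efg]]; case: g / efg us => us eus; congr TApp; apply/ffunP=> i.
  have [v [uv tv]] := ets i; have [w [uw tw]] := eus i.
  by move: uv uw tw; rewrite /edge => -> [<-]; apply: IH.
Qed.

(** Together with [walk_rep], this identifies the walks from [u] with the positions of [t]. The
    arity condition turns an existing edge into a valid argument index. *)
Lemma rep_walk G u t p v : wf_labels G -> rep G u t -> walk G u p v ->
  exists2 t', subterm_at t p = Some t' & rep G v t'.
Proof.
move=> [wf_fun wf_var]; elim: p u t => [|i p IH] u t /=.
  by move=> tu <-; exists t => //; case: (t).
case: t => [x|f ts] /= => [/wf_var su|[/wf_fun su sub]] [w [uw wv]].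
  by move: uw; rewrite /edge su onth0n.
have lt_i : i < ar f by rewrite -su -onthTE; move: uw; rewrite /edge => ->.
have [w' [uw' tw]] := sub (Ordinal lt_i).
case: insubP => [j _ ej|]; last by rewrite lt_i.
have -> : j = Ordinal lt_i by apply: val_inj.
by move: uw' tw; rewrite /edge uw => -[<-] tw; apply: IH wv.
Qed.

Lemma walk_rep G u t p t' : rep G u t -> subterm_at t p = Some t' ->
  exists2 v, walk G u p v & rep G v t'.
Proof.
elim: p u t => [|i p IH] u t /=; first by case: t => [x|f ts] tu [<-]; exists u.
case: t => [|f ts] //= [_ sub]; case: insubP => // j _ <- e.
have [v [uv /IH/(_ e)[w vw tw]]] := sub j.
by exists w => //; exists v.
Qed.

(** A cycle through [u] would make [t] a proper subterm of itself. *)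
Lemma rep_acyclic G u t p : wf_labels G -> rep G u t -> walk G u p u -> p = [::].
Proof.
move=> wf tu cyc; have [t' e t'u] := rep_walk wf tu cyc.
by apply: (subterm_at_self (t := t)); rewrite e (rep_uniq tu t'u).
Qed.

Lemma subgraph_fnd S u v : reach S u v -> (subgraph S u : graph).[? v] = (S : graph).[? v].
Proof. by move=> uv; rewrite /= fnd_filterf asboolT. Qed.

Lemma subgraph_lab S u v : reach S u v -> lab (subgraph S u) v = lab S v.
Proof. by rewrite /lab => /subgraph_fnd->. Qed.

Lemma subgraph_succ S u v : reach S u v -> succ (subgraph S u) v = succ S v.
Proof. by rewrite /succ => /subgraph_fnd->. Qed.

Lemma subgraph_nodes S u v : v \in nodes (subgraph S u) <-> v \in nodes S /\ reach S u v.
Proof.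
rewrite /nodes domf_filterf !inE /=; split=> [/andP[vS /asboolP uv]|[vS uv]] //.
by apply/andP; split=> //; apply/asboolP.
Qed.

Lemma subgraph_walk S u v p w : reach S u v ->
  walk (subgraph S u) v p w <-> walk S v p w.
Proof.
elim: p v => [|i p IH] v uv //=.
by split=> -[x [vx xw]]; exists x; move: vx; rewrite /edge subgraph_succ // => vx;
   split=> //; apply/IH => //; apply: reach_trans uv (edge_reach vx).
Qed.

Lemma rep_subgraph S u v t : reach S u v -> rep (subgraph S u) v t <-> rep S v t.
Proof.
elim/nested_term_ind: t v => [x|f ts IH] v uv; rewrite /= subgraph_lab //.
split=> -[-> sub]; split=> // i; have [w [vw tw]] := sub i; exists w;
  move: vw; rewrite /edge subgraph_succ // => vw; split=> //; apply/IH => //;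
  exact: reach_trans uv (edge_reach vw).
Qed.

(** The induction generalizes over [S], since the recursion of [represents] passes to subgraphs of
    subgraphs. *)
Lemma represents_subgraph S u t : represents (subgraph S u) t <-> rep S u t.
Proof.
elim/nested_term_ind: t S u => [x|f ts IH] S u.
  by rewrite /= subgraph_lab //; apply: reach_refl.
rewrite /= subgraph_lab; last exact: reach_refl.
split=> -[-> sub]; split=> // i; have [v [uv tv]] := sub i; exists v;
  move: uv; rewrite /edge subgraph_succ ?/subgraph; try exact: reach_refl;
  move=> uv; split=> //.
  by move: tv => /IH/rep_subgraph; apply; apply: edge_reach uv.
by apply/IH/rep_subgraph => //; apply: edge_reach uv.
Qed.

Lemma represents_rep S t : represents S t <-> rep S (rt S) t.
Proof.
case: t => [x|f ts] //=; split=> -[-> sub]; split=> // i;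
  by have [v [e tv]] := sub i; exists v; split=> //; apply/represents_subgraph.
Qed.

Lemma term_graph_wf S : is_term_graph ar S -> wf_labels S.
Proof. by case. Qed.

Lemma walk_nodes S u p v :
  is_term_graph ar S -> u \in nodes S -> walk S u p v -> v \in nodes S.
Proof.
move=> tgS; elim: p u => [|i p IH] u uS /=; first by move=> <-.
by case=> w [/edge_mem uw]; apply: IH; apply: tg_closed tgS _ _ uS uw.
Qed.

(** By acyclicity the root is reached only by the empty walk, so the separate clause for the root
    agrees with the general one. *)
Lemma posE S u p : is_term_graph ar S -> pos S u p <-> walk S (rt S) p u.
Proof.
move=> tgS; have rtS := (tg_root tgS).1; rewrite /pos.
split=> [[_]|up]; first by case: eqP => [-> ->|].
split; first exact: walk_nodes up.
by case: eqP => // eu; move: up; rewrite eu => /(tg_acyclic tgS).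
Qed.

Lemma node_rep S t u : is_term_graph ar S -> rep S (rt S) t -> u \in nodes S ->
  exists t', rep S u t'.
Proof.
move=> tgS tS uS; have [p up] := (tg_root tgS).2 u uS.
by have [t' _ ?] := rep_walk (term_graph_wf tgS) tS up; exists t'.
Qed.

(** A term at the root supplies the remaining conditions: every node reached represents a subterm,
    hence is a node and lies on no cycle; a second root would lie on a cycle through the first. *)
Lemma term_graphI S t : wf_labels S -> rep S (rt S) t ->
    (forall u, u \in nodes S -> reach S (rt S) u) ->
    (forall u v x, lab S u = Some (inr x) -> lab S v = Some (inr x) -> u = v) ->
  is_term_graph ar S.
Proof.
move=> wf tS allreach uvar.
have acyc u p : walk S u p u -> p = [::].
  case: p => // i p cyc; have [w [/edge_nodes uS _]] := cyc.
  have [q uq] := allreach u uS; have [t' _ tu] := rep_walk wf tS uq.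
  exact: rep_acyclic tu cyc.
split=> //; try by case: wf.
- move=> u v uS /onthP[i uv]; have [q uq] := allreach u uS.
  have vq : walk S (rt S) (rcons q i) v by apply/walk_rcons; exists u.
  by have [t' _ /rep_nodes] := rep_walk wf tS vq.
- by split=> //; apply: rep_nodes tS.
- move=> r [rS fromr]; have [p rp] := allreach r rS.
  have [q rq] := fromr _ (rep_nodes tS).
  have /acyc : walk S r (q ++ p) r by apply/walk_cat; exists (rt S).
  by case: q rq => [|//] /= ->.
Qed.

(** * Morphisms preserving all nodes: transport of walks and terms in both directions *)

Section GMorphism.
Variables (m : N -> N) (S T : rooted_graph).
Hypothesis mST : gmorphism m S T.

Let pres u : u \in nodes S -> preserves S T m u. Proof. exact: mST.2. Qed.

Lemma gmorphism_edge u i v : edge S u i v -> edge T (m u) i (m v).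
Proof.
by move=> e; rewrite /edge (pres (edge_nodes e)).2 onth_map e.
Qed.

Lemma gmorphism_walk u p v : walk S u p v -> walk T (m u) p (m v).
Proof.
elim: p u => [|i p IH] u /= => [->//|[w [uw wv]]].
by exists (m w); split; [apply: gmorphism_edge | apply: IH].
Qed.

Lemma gmorphism_rep u t : rep S u t -> rep T (m u) t.
Proof.
elim/nested_term_ind: t u => [x|f ts IH] u tu.
  by rewrite /= (pres (rep_nodes tu)).1.
rewrite /= (pres (rep_nodes tu)).1; case: tu => -> sub; split=> // i.
by have [v [uv tv]] := sub i; exists (m v); split; [apply: gmorphism_edge | apply: IH].
Qed.

Hypothesis closedS : forall u v, u \in nodes S -> v \in succ S u -> v \in nodes S.

Lemma gmorphism_edge_lift u i y : u \in nodes S -> edge T (m u) i y ->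
  exists2 x, edge S u i x & m x = y.
Proof.
move=> uS; rewrite /edge (pres uS).2 onth_map.
by case: (onth _ _) => //= x [<-]; exists x.
Qed.

Lemma gmorphism_walk_lift u p y : u \in nodes S -> walk T (m u) p y ->
  exists2 x, walk S u p x & m x = y.
Proof.
elim: p u => [|i p IH] u uS /=; first by move=> <-; exists u.
case=> w [/(gmorphism_edge_lift uS)[v uv <-]].
case/IH=> [|x vx <-]; first exact: closedS uS (edge_mem uv).
by exists x => //; exists v.
Qed.

Lemma gmorphism_rep_lift u t : u \in nodes S -> rep T (m u) t -> rep S u t.
Proof.
elim/nested_term_ind: t u => [x|f ts IH] u uS /=; rewrite (pres uS).1 //.
case=> -> sub; split=> // i.
have [w [/(gmorphism_edge_lift uS)[v uv <-] tv]] := sub i.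
by exists v; split=> //; apply: IH => //; apply: closedS uS (edge_mem uv).
Qed.

End GMorphism.

(** This is used for collapsed graphs and for renamed copies of rules. *)
Lemma term_graph_image m S T t : gmorphism m S T ->
    (forall y, y \in nodes T -> exists2 x, x \in nodes S & m x = y) ->
  is_term_graph ar S -> rep S (rt S) t ->
  is_term_graph ar T /\ rep T (rt T) t.
Proof.
move=> mST onto tgS tS; have [[_ mrt _] pres] := mST.
have tT : rep T (rt T) t by rewrite -mrt; apply: gmorphism_rep mST _ _ tS.
split=> //; apply: term_graphI tT _ _.
- split=> u a ua; have [x xS xu] := onto u (lab_nodes ua);
    move: ua; rewrite -xu; have [-> ->] := pres x xS.
    by rewrite size_map; apply: tg_fun tgS _ _.
  by move/(tg_var tgS) => ->.
- move=> y /onto[x xS <-]; have [p xp] := (tg_root tgS).2 x xS.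
  by exists p; rewrite -mrt; apply: gmorphism_walk mST _ _ _ xp.
- move=> y z a ya za; have [x xS xy] := onto y (lab_nodes ya).
  have [x' x'S x'z] := onto z (lab_nodes za).
  move: ya za; rewrite -xy -x'z (pres x xS).1 (pres x' x'S).1.
  by move=> xa x'a; rewrite (tg_var_unique tgS xa x'a).
Qed.

(** This is used for unfolding, where [S] is the larger graph. Injectivity on variable nodes keeps
    each variable on a single node. *)
Lemma term_graph_preimage m S T t : gmorphism m S T ->
    (forall u v, u \in nodes S -> v \in succ S u -> v \in nodes S) ->
    rt S \in nodes S -> (forall u, u \in nodes S -> reach S (rt S) u) ->
    (forall u v x, lab S u = Some (inr x) -> m u = m v -> u = v) ->
  is_term_graph ar T -> rep T (rt T) t ->
  is_term_graph ar S /\ rep S (rt S) t.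
Proof.
move=> mST closed rtS allreach inj_var tgT tT; have [[_ mrt _] pres] := mST.
have tS : rep S (rt S) t.
  by apply: (gmorphism_rep_lift mST closed rtS); rewrite mrt.
split=> //; apply: term_graphI tS allreach _.
- split=> u a ua; have [] := pres u (lab_nodes ua); rewrite ua.
    by move=> /(tg_fun tgT) <- ->; rewrite size_map.
  by move=> /(tg_var tgT) -> /esym/(congr1 size); rewrite size_map => /size0nil.
- move=> u v x ux vx; apply: (inj_var u v x ux).
  have [mu _] := pres u (lab_nodes ux); have [mv _] := pres v (lab_nodes vx).
  by apply: (tg_var_unique tgT) (etrans mu ux) (etrans mv vx).
Qed.


(** * Collapsing, and termination of folding and unfolding *)

Lemma gmorphism_onto m S T : is_term_graph ar S -> is_term_graph ar T ->
  gmorphism m S T -> forall y, y \in nodes T -> exists2 x, x \in nodes S & m x = y.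
Proof.
move=> tgS tgT mST y yT; have [p] := (tg_root tgT).2 y yT.
have rtS := (tg_root tgS).1; have [[_ <- _] _] := mST => py.
have [x px <-] := gmorphism_walk_lift mST (tg_closed tgS) rtS py.
by exists x => //; apply: walk_nodes px.
Qed.

(** All nodes of [T] are images of nodes of [S], and [u] is no image because [v] differs from it. *)
Lemma collapse_card S u v T : collapse ar S u v T -> #|` nodes T| < #|` nodes S|.
Proof.
case=> tgS tgT uS vS [vu mST]; apply: fproper_ltn_card.
have uT : u \notin nodes T.
  apply/negP => /(gmorphism_onto tgS tgT mST)[x xS].
  by case: eqP => // _ evu; rewrite evu ltxx in vu.
rewrite fproperE; apply/andP; split; last by apply: contra uT => /fsubsetP; apply.
apply/fsubsetP=> y yT.
have [x xS <-] := gmorphism_onto tgS tgT mST yT.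
by case: eqP.
Qed.

Lemma collapse_rep S u v T t : collapse ar S u v T -> rep S (rt S) t <-> rep T (rt T) t.
Proof.
case=> tgS tgT uS vS [vu mST]; have [[_ <- _] _] := mST.
split; first exact: gmorphism_rep mST _ _.
exact: gmorphism_rep_lift mST (tg_closed tgS) _ _ (tg_root tgS).1.
Qed.

Definition graph_of t S : Prop := is_term_graph ar S /\ rep S (rt S) t.

(** Choosing a position for each node is injective, as a walk determines its end. *)
Lemma graph_of_card t S : graph_of t S -> #|` nodes S| <= size (positions t).
Proof.
case=> tgS tS.
have /choice[pos_of walk_pos] u : exists p, u \in nodes S -> walk S (rt S) p u.
  by case: (boolP (u \in nodes S)) => [/(tg_root tgS).2[p up]|_]; [exists p | exists [::]].
have inj : {in nodes S &, injective pos_of}.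
  move=> u v uS vS e; apply: walk_det (walk_pos u uS) _.
  by rewrite e; apply: walk_pos.
rewrite -(size_map pos_of); apply: uniq_leq_size.
  by rewrite map_inj_in_uniq // fset_uniq.
move=> p /mapP[u uS ->].
by have [t' /mem_positions] := rep_walk (term_graph_wf tgS) tS (walk_pos u uS).
Qed.

Lemma unfold_step_graph_of t p S T : graph_of t S -> unfold_step ar p S T ->
  graph_of t T /\ #|` nodes S| < #|` nodes T|.
Proof.
move=> [tgS tS] [u [v [q [col _ _]]]]; split; last exact: collapse_card col.
by split; [case: col | apply/(collapse_rep _ col)].
Qed.

Lemma fold_step_graph_of t p S T : graph_of t S -> fold_step ar p S T ->
  graph_of t T /\ #|` nodes T| < #|` nodes S|.
Proof.
move=> [tgS tS] [u [v [_ _ col]]]; split; last exact: collapse_card col.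
by split; [case: col | apply/(collapse_rep _ col)].
Qed.

Lemma unfold_normalizes_exists t p S : graph_of t S ->
  exists T, normalizes (unfold_step ar p) S T.
Proof.
apply: (normalizes_exists (mu := fun S => size (positions t) - #|` nodes S|)).
move=> A B gA step; have [gB lt_AB] := unfold_step_graph_of gA step.
(* The truncated difference drops strictly because the larger graph [B] still obeys the bound. *)
by split=> //; apply: ltn_sub2l => //; apply: leq_trans lt_AB (graph_of_card gB).
Qed.

Lemma fold_normalizes_exists t p S : graph_of t S ->
  exists T, normalizes (fold_step ar p) S T.
Proof.
apply: (normalizes_exists (mu := fun S => #|` nodes S|)) => A B.
exact: fold_step_graph_of.
Qed.


(** * Normal forms of folding are maximally shared strictly below the position *)

Lemma map_succ_fnd (h : N -> N) G u :
  (map_succ h G).[? u] = omap (fun a => (a.1, map h a.2)) G.[? u].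
Proof.
rewrite /map_succ; case: (boolP (u \in domf G)) => uG; last by rewrite !not_fnd.
by rewrite !in_fnd ffunE (eq_getf _ uG); case: G.[uG].
Qed.

(** Deleting [u] and redirecting its incoming edges to [v] gives a morphic image, since [u] and [v]
    carry the same data. As [u] is not the root, the root survives. *)
Lemma collapse_exists t S u v : graph_of t S -> u \in nodes S -> v \in nodes S ->
    u <> rt S -> (v < u)%O -> lab S u = lab S v -> succ S u = succ S v ->
  exists T, collapse ar S u v T.
Proof.
move=> [tgS tS] uS vS urt vu elab esucc.
pose m w := if w == u then v else w.
have mNu w : m w != u by rewrite /m; case: (w =P u) => [_|/eqP//]; rewrite lt_eqF.
pose T := RootedGraph (map_succ m (gr S).[~ u]) (rt S).
have T_fnd w : w != u -> (T : graph).[? w] = omap (fun a => (a.1, map m a.2)) (gr S).[? w].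
  by move=> wu; rewrite /= map_succ_fnd fnd_rem1 wu.
have nodesT w : w \in nodes T = (w != u) && (w \in nodes S).
  by rewrite /nodes /= mem_remf1.
have labm w : lab S (m w) = lab S w by rewrite /m; case: eqP => // ->.
have succm w : succ S (m w) = succ S w by rewrite /m; case: eqP => // ->.
have mS w : w \in nodes S -> m w \in nodes S by rewrite /m; case: eqP.
have mST : gmorphism m S T.
  have pres w : preserves S T m w.
    rewrite /preserves -(labm w) -(succm w) /lab /succ T_fnd //.
    by case: (gr S).[? m w].
  split=> //; split=> // [w wS|]; first by rewrite nodesT mNu mS.
  by rewrite /m; case: eqP => // /esym.
exists T; split=> //.
suff [] : graph_of t T by [].
apply: term_graph_image mST _ tgS tS => w; rewrite nodesT => /andP[wu wS].
by exists w => //; rewrite /m (negPf wu).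
Qed.

Lemma strictly_below_edge S p u i v : is_term_graph ar S ->
  strictly_below S p u -> edge S u i v -> strictly_below S p v.
Proof.
move=> tgS [q [/(posE _ _ tgS) qu /andP[pq _]]] uv; exists (rcons q i); split.
  by apply/posE => //; apply/walk_rcons; exists u.
rewrite /proper_prefix (prefix_trans pq) ?prefix_rcons //=.
by apply/eqP => e; have := size_prefix pq; rewrite e size_rcons ltnn.
Qed.

Lemma fold_normal_shared t p S : graph_of t S -> ~ (exists T, fold_step ar p S T) ->
  forall t' u v, strictly_below S p u -> strictly_below S p v ->
  rep S u t' -> rep S v t' -> u = v.
Proof.
move=> gS nf; have [tgS tS] := gS.
elim/nested_term_ind => [x|f ts IH] u v pu pv.
  by move=> ux vx; apply: (tg_var_unique tgS ux vx).
move=> tu tv; have uS := rep_nodes tu; have vS := rep_nodes tv.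
case: tu tv => [uf usub] [vf vsub].
(* The root has only the empty position, which has no proper prefix. *)
have notrt w : strictly_below S p w -> w <> rt S.
  by move=> [q [[_ +] /andP[pq npq]]] e; rewrite e eqxx => eq;
     move: pq npq; rewrite eq prefixs0 => ->.
have esucc : succ S u = succ S v.
  have su := tg_fun tgS uf; have sv := tg_fun tgS vf.
  apply: eq_from_onth => i; case: (ltnP i (ar f)) => le_i; last first.
    by rewrite !onth_default // ?su ?sv.
  have [u' [uu' tu']] := usub (Ordinal le_i); have [v' [vv' tv']] := vsub (Ordinal le_i).
  rewrite -[RHS]/(onth _ (Ordinal le_i)) vv' -[LHS]/(onth _ (Ordinal le_i)) uu'.
  by congr Some; apply: IH tu' tv';
    [apply: strictly_below_edge uu' | apply: strictly_below_edge vv'].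
(* Stated for arbitrary [a] and [b], because the node order decides which of [u] and [v] would be
   removed. *)
have no_collapse a b : strictly_below S p a -> strictly_below S p b ->
    lab S a = lab S b -> succ S a = succ S b -> a \in nodes S -> b \in nodes S ->
    ~ (b < a)%O.
  move=> pa pb eab sab aS bS ba.
  have [T col] := collapse_exists gS aS bS (notrt a pa) ba eab sab.
  by apply: nf; exists T, a, b.
case: (ltgtP u v) => // cmp; exfalso.
  by apply: (no_collapse v u) cmp => //; rewrite uf.
by apply: (no_collapse u v) cmp => //; rewrite uf.
Qed.

(** * Fresh nodes, and normal forms of unfolding *)

Hypothesis unbounded : forall v, exists u, (v < u)%O.

(** A node above all of [A] is fresh for [A]; being above [v] as well, it may be collapsed onto
    [v]. *)
Lemma node_above v (A : {fset N}) : exists2 n, (v < n)%O & forall x, x \in A -> (x < n)%O.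
Proof.
suff [n vn An] : exists2 n, (v < n)%O & forall x, x \in enum_fset A -> (x < n)%O by exists n.
elim: (enum_fset A) => [|a s [n vn sn]]; first by have [n] := unbounded v; exists n.
have [k ak] := unbounded (Order.max a n); exists k => [|x].
  by apply: lt_trans vn _; apply: le_lt_trans ak; rewrite le_max lexx orbT.
rewrite inE => /orP[/eqP->|/sn xn].
  by apply: le_lt_trans ak; rewrite le_max lexx.
by apply: lt_trans xn _; apply: le_lt_trans ak; rewrite le_max lexx orbT.
Qed.

Lemma onth_set_nth (X : Type) (d : X) s i y j : i < size s ->
  onth (set_nth d s i y) j = if j == i then Some y else onth s j.
Proof. by elim: s i j => [|x s IH] [|i] [|j] //= /IH ->. Qed.

Lemma unfold_exists t S w' q' i w q : graph_of t S ->
    (forall p, walk S (rt S) p w' -> p = q') -> walk S (rt S) q' w' ->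
    edge S w' i w -> ~ var_node S w -> walk S (rt S) q w -> q <> rcons q' i ->
  exists T n, collapse ar T n w S /\ unshared_at T n (rcons q' i).
Proof.
move=> [tgS tS] uniq_w' q'w' w'w wNvar qw qNq'.
have [n wn Sn] := node_above w (nodes S).
have nNS x : x \in nodes S -> x != n by move/Sn => xn; rewrite lt_eqF.
have w'S := edge_nodes w'w; have wS := tg_closed tgS w'S (edge_mem w'w).
have lt_i : i < size (succ S w') by rewrite -onthTE; move: w'w; rewrite /edge => ->.
have w'Nw : w' <> w.
  move=> e; have /(tg_acyclic tgS) // : walk S w [:: i] w.
  by exists w; rewrite -{1}e.
pose T := RootedGraph
  (gr S).[w' <- ((gr S).[w'S].1, set_nth n (succ S w') i n)].[n <- (gr S).[wS]] (rt S).
(* This map undoes the unfolding by sending the copy back to [w]. *)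
pose m x := if x == n then w else x.
have mid x : x \in nodes S -> m x = x by move/nNS; rewrite /m => /negPf->.
have nodesT x : x \in nodes T = (x == n) || (x \in nodes S).
  rewrite /nodes /= !inE; case: (x == n) => //=.
  by case: eqP => // ->; rewrite w'S.
have mT x : x \in nodes T -> m x \in nodes S.
  by rewrite nodesT /m; case: eqP.
have labT x : lab T x = lab S (m x).
  rewrite /lab /= fnd_set /m; case: eqP => [_|_]; first by rewrite in_fnd.
  by rewrite fnd_set; case: eqP => // ->; rewrite in_fnd.
have succT x : x \in nodes T ->
    succ T x = if x == w' then set_nth n (succ S w') i n else succ S (m x).
  rewrite nodesT /succ /= fnd_set /m; case: eqP => [-> _|_ /= xS].
    by rewrite !in_fnd /= [n == w']eq_sym (negPf (nNS w' w'S)).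
  by rewrite fnd_set; case: eqP.
have mapm us : {subset us <= nodes S} -> map m us = us.
  by move=> sub; apply: map_id_in => x /sub/mid.
have succS x : x \in nodes S -> {subset succ S x <= nodes S}.
  by move=> xS y; apply: tg_closed tgS _ _ xS.
have pres x : x \in nodes T -> preserves T S m x.
  move=> xT; split; rewrite ?labT // succT //; case: eqP => [->|_]; last first.
    by rewrite mapm //; apply: succS (mT x xT).
  apply: eq_from_onth => j; rewrite mid // onth_map onth_set_nth //.
  case: eqP => [->|_]; first by rewrite w'w /= /m eqxx.
  case e: (onth _ _) => [y|] //=; rewrite mid //.
  by apply: (succS w' w'S); apply/onthP; exists j.
have rtS := (tg_root tgS).1; have rtT : rt T \in nodes T by rewrite nodesT rtS orbT.
have mTS : gmorphism m T S.
  split=> //; split=> [x||x f /lab_nodes]; [exact: mT | exact: mid | exact: pres].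
have closedT x y : x \in nodes T -> y \in succ T x -> y \in nodes T.
  move=> xT yx; have my : m y \in nodes S.
    by apply: (succS (m x)); rewrite ?mT // (pres x xT).2 map_f.
  by move: my; rewrite nodesT /m; case: eqP.
have into_n x j : edge T x j n -> x = w' /\ j = i.
  move=> e; have xT := edge_nodes e; move: e; rewrite /edge succT //.
  case: eqP => [->|_]; first rewrite onth_set_nth //; first case: eqP => // _.
    by move=> e; have /nNS := succS w' w'S n (edge_mem e); rewrite eqxx.
  by move=> e; have /nNS := succS (m x) (mT x xT) n (edge_mem e); rewrite eqxx.
(* Walks of [S] lift to [T]; a lifted end can differ from the original only by being [n] instead of
   [w]. *)
have walkT x p : walk S (rt S) p x -> exists2 y, walk T (rt T) p y & m y = x.
  by move=> px; apply: gmorphism_walk_lift mTS closedT _ _ _ rtT _; rewrite mid.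
have m_id_inv x y : m y = x -> x <> w -> y = x.
  by rewrite /m; case: eqP => // _ <-.
have q'w'T : walk T (rt T) q' w'.
  by have [y yw' /m_id_inv/(_ w'Nw) <-] := walkT w' q' q'w'.
have nT : n \in nodes T by rewrite nodesT eqxx.
have posn p : walk T (rt T) p n <-> p = rcons q' i.
  split=> [|->]; last first.
    apply/walk_rcons; exists w'; split=> //.
    by rewrite /edge succT ?nodesT ?w'S ?orbT // eqxx onth_set_nth // eqxx.
  case/lastP: p => [e|p j /walk_rcons[x [px /into_n[ex ->]]]].
    by have /nNS := rtS; rewrite -e eqxx.
  congr rcons; apply: uniq_w'.
  by have := gmorphism_walk mTS px; rewrite ex !mid.
(* The lift of [q] ends in [w] or [n], and [posn] excludes [n]. *)
have qw_T : walk T (rt T) q w.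
  have [y yw] := walkT w q qw; rewrite /m; case: eqP => [ey _|_ <- //].
  by move: yw; rewrite ey => /posn.
have gT : graph_of t T.
  apply: (term_graph_preimage mTS closedT rtT _ _ tgS tS) => [x xT|x y a xa].
    case: (x =P n) => [->|xn]; first by exists (rcons q' i); apply/posn.
    case: (x =P w) => [->|xw]; first by exists q.
    have xS : x \in nodes S by have := mT x xT; rewrite /m; case: eqP.
    have [p /walkT[z zx /m_id_inv/(_ xw) ez]] := (tg_root tgS).2 x xS.
    by exists p; rewrite -ez.
  (* The map identifies only [n] and [w], neither of which is a variable node. *)
  have mxNw : m x <> w by move=> e; apply: wNvar; exists a; rewrite -e -labT.
  move=> exy; move: mxNw; rewrite {1}/m; case: eqP => // xn xw.
  apply/esym/m_id_inv => //; rewrite -exy.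
  by rewrite /m; case: eqP.
exists T, n; split; last by move=> p; rewrite posE //; case: gT.
by case: gT => tgT _; split=> //; rewrite nodesT wS orbT.
Qed.

(** The claim is proved for all prefixes of [p], from the root downwards. An application at [p] is
    required because a shared variable node cannot be unfolded. *)
Lemma unfold_normal_unshared t S p f (ts : {ffun 'I_(ar f) -> term}) :
    graph_of t S -> ~ (exists T, unfold_step ar p S T) ->
    subterm_at t p = Some (TApp ts) -> exists u, unshared_at S u p.
Proof.
move=> gS nf e; have [tgS tS] := gS.
have [u pu [uf _]] := walk_rep tS e.
suff uniq_pos q : prefix q p -> forall w, walk S (rt S) q w ->
    forall q2, walk S (rt S) q2 w -> q2 = q.
  exists u => q; rewrite posE //; split=> [qu|->//].
  exact: uniq_pos (prefix_refl p) _ pu _ qu.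
elim/last_ind: q => [_ w <- q2 cyc|q i IH qi_p w /walk_rcons[w' [qw' w'w]] q2 q2w].
  exact: (tg_acyclic tgS cyc).
apply: contrapT => q2Nqi.
have qp : prefix q p by apply: prefix_trans qi_p; apply: prefix_rcons.
(* The walk continues from [w] to [u], which is labelled by a function symbol, while a variable node
   has no successors. *)
have wNvar : ~ var_node S w.
  move=> [x wx]; have [r er] := prefixP qi_p.
  have [w1 [/walk_rcons[w2 [w2q w2w1]]]] : exists w1,
      walk S (rt S) (rcons q i) w1 /\ walk S w1 r u.
    by apply/walk_cat; rewrite -er.
  have ew2 := walk_det w2q qw'; move: w2w1; rewrite ew2 /edge w'w => -[<-].
  case: r {er} => [|j r] /=; first by move=> ewu; move: wx; rewrite ewu uf.
  by case=> y [+ _]; rewrite /edge (tg_var tgS wx) onth0n.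
have [T [n [col nq]]] := unfold_exists gS (IH qp w' qw') qw' w'w wNvar q2w q2Nqi.
by apply: nf; exists T, n, w, (rcons q i).
Qed.


(** As [p] is its only position, [u] is not strictly below [p], so it is neither of the two nodes
    merged. Walks to it in [T] therefore lift to walks to it in [S]. *)
Lemma fold_step_unshared p S T u :
  fold_step ar p S T -> unshared_at S u p -> unshared_at T u p.
Proof.
move=> [a [b [pa pb [tgS tgT _ _ [_ mST]]]]] pu.
have not_below w : strictly_below S p w -> (u == w) = false.
  by move=> [q [qw /andP[_ npq]]]; apply/eqP => euw; move: qw npq;
    rewrite -euw => /pu ->; rewrite eqxx.
have rtS := (tg_root tgS).1; have [[_ mrt _] _] := mST.
move=> q; rewrite posE // -mrt; split=> [|eqp].
  case/(gmorphism_walk_lift mST (tg_closed tgS) rtS) => x qx.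
  case: eqP => [_ ebu|_ exu]; first by have := not_below _ pb; rewrite ebu eqxx.
  by apply/pu/posE; rewrite -?exu.
have /pu/(posE _ _ tgS)/(gmorphism_walk mST) := eqp.
by rewrite (not_below a pa).
Qed.

Lemma normal_unshared t p S S1 S2 f (ts : {ffun 'I_(ar f) -> term}) :
    graph_of t S -> normalizes (unfold_step ar p) S S1 ->
    normalizes (fold_step ar p) S1 S2 -> subterm_at t p = Some (TApp ts) ->
  exists u, unshared_at S2 u p.
Proof.
move=> gS S_S1 S1_S2 e.
have gS1 : graph_of t S1.
  by apply: (normalizes_inv _ gS S_S1) => A B gA /(unfold_step_graph_of gA)[].
have [u pu] := unfold_normal_unshared gS1 S_S1.2 e.
exists u; apply: (normalizes_inv (I := fun S => unshared_at S u p) _ pu S1_S2) => A B Au AB.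
exact: fold_step_unshared AB Au.
Qed.

(** * Properties of rules that survive renaming, and substitutions read off from morphisms *)

Record rule_graphs (l r : term) L R : Prop := RuleGraphs {
  rg_lhs : graph_of l L;
  rg_rhs : graph_of r R;
  rg_root : ~ var_node L (rt L);
  rg_common : forall u, u \in nodes L -> u \in nodes R ->
    exists x, lab L u = Some (inr x) /\ lab R u = Some (inr x);
  rg_var : forall u, var_node R u -> u \in nodes L
}.

Lemma simulates_rule_graphs l r L R :
  simulates_rule (l, r) (L, R) -> rule_graphs l r L R.
Proof.
case=> [[_ _ share [Lroot _ _]] [tgL tL _] [tgR tR _] common]; split=> //.
- by split=> //; apply/represents_rep.
- by split=> //; apply/represents_rep.
- move=> u uL uR; have /common[x ux] : u \in nodes L `&` nodes R by rewrite inE uL.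
  by exists x; rewrite (share u uL uR).1.
- by move=> u /common; rewrite inE => /andP[].
Qed.

Lemma renaming_gmorphism rho S T : renaming_of rho S T -> gmorphism rho S T.
Proof.
case=> eT ert pres; split=> //; split=> [u uS||u f /lab_nodes] //; last exact: pres.
by rewrite eT; apply: in_imfset.
Qed.

Lemma renaming_graph_of rho S T t :
  renaming_of rho S T -> graph_of t S -> graph_of t T.
Proof.
move=> ren [tgS tS]; apply: (term_graph_image (renaming_gmorphism ren)) tgS tS => y.
by case: ren => -> _ _ /imfsetP[x xS ->]; exists x.
Qed.

Lemma isomorphic_copy_rule_graphs l r g L R :
  simulates_rule (l, r) g -> isomorphic_copy g (L, R) -> rule_graphs l r L R.
Proof.
case: g => L0 R0 /simulates_rule_graphs[gL gR Lroot common Rvar] [rho [inj renL renR]].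
have [nL rtL presL] := renL; have [nR rtR presR] := renR; split.
- exact: renaming_graph_of renL gL.
- exact: renaming_graph_of renR gR.
- move=> [x]; rewrite rtL (presL _ (tg_root gL.1).1).1 => xrt.
  by apply: Lroot; exists x.
- move=> u; rewrite nL nR => /imfsetP[a /= aL ->] /imfsetP[b /= bR] eab.
  (* Injectivity on the union of both node sets ensures that the copies share only copies of shared
     nodes. *)
  have e : a = b by apply: inj => //; rewrite inE ?aL ?bR ?orbT.
  have aR : a \in nodes R0 by rewrite e.
  have [x [xL xR]] := common a aL aR; exists x.
  by rewrite (presL a aL).1 (presR a aR).1.
- move=> u [x ux]; have := lab_nodes ux; rewrite nR => /imfsetP[b /= bR eub].
  rewrite nL eub; apply: in_imfset; apply: Rvar; exists x.
  by rewrite -(presR b bR).1 -eub.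
Qed.

Lemma morphism_subst s l S L u m : graph_of s S -> graph_of l L ->
    morphism m L (subgraph S u) ->
  exists sigma, forall w l', rep L w l' -> rep S (m w) (subst sigma l').
Proof.
move=> [tgS tS] [tgL tL] [mnodes mrt pres].
(* The value at [x] is the term at the image of the unique node labelled [x]; if there is none, [x]
   itself serves as default. *)
have /choice[sigma sigmaP] x : exists t, forall w, lab L w = Some (inr x) -> rep S (m w) t.
  have [[w wx]|nex] := pselect (exists w, lab L w = Some (inr x)); last first.
    by exists (TVar ar x) => w wx; case: nex; exists w.
  have /subgraph_nodes[mwS _] := mnodes w (lab_nodes wx).
  have [t mwt] := node_rep tgS tS mwS.
  by exists t => w' w'x; rewrite (tg_var_unique tgL w'x wx).
exists sigma => w l'; elim/nested_term_ind: l' w => [x|f ts IH] w /=; first exact: sigmaP.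
move=> [wf sub]; have [] := pres w f wf.
have /subgraph_nodes[_ umw] := mnodes w (lab_nodes wf).
rewrite subgraph_lab // subgraph_succ // wf => -> emw; split=> // i.
have [v [wv tv]] := sub i; exists (m v); rewrite ffunE; split; last exact: IH.
by rewrite /edge emw onth_map wv.
Qed.

(** A morphism respects edges only at function nodes, but variable nodes have none. *)
Lemma morphism_walk S L u m w q v : morphism m L (subgraph S u) -> is_term_graph ar L ->
  walk L w q v -> walk S (m w) q (m v).
Proof.
move=> [mnodes mrt pres] tgL; elim: q w => [|i q IH] w /= => [->//|[z [wz zv]]].
exists (m z); split; last exact: IH.
have wL := edge_nodes wz; have /subgraph_nodes[_ umw] := mnodes w wL.
have [[f|x] wf] := nodes_lab wL.
  by have [_] := pres w f wf; rewrite subgraph_succ // /edge => ->; rewrite onth_map wz.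
by move: wz; rewrite /edge (tg_var tgL wf) onth0n.
Qed.

(** * Overwriting an unshared node rewrites exactly one position of the term *)

Section GraphRewrite.
Variables (s l r : term) (S L R : rooted_graph) (u : N) (p : position) (m : N -> N).
Hypotheses (gS : graph_of s S) (u_at_p : unshared_at S u p).
Hypotheses (ruleLR : rule_graphs l r L R).
Hypotheses (fresh : [disjoint nodes L `|` nodes R & nodes S]).
Hypotheses (mLS : morphism m L (subgraph S u)).

Let mbar v := if v \in nodes L then m v else v.
Let redirect v := if v == u then mbar (rt R) else v.
Let images := m @` (nodes R `&` nodes L).
(** This is the graph built by [replace_node] before its restriction to reachable nodes. *)
Let G : graph := map_succ redirect (gr S).[~ u] + gr (instantiate L R m S).
Let tgS : is_term_graph ar S := gS.1.
Let up : walk S (rt S) p u.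
Proof. by apply/posE => //; apply/u_at_p. Qed.

Let below_not_reach q v : q <> [::] -> walk S u q v -> ~ reach S v u.
Proof.
move=> qn uv [q' vu]; have /(tg_acyclic tgS) : walk S u (q ++ q') u.
  by apply/walk_cat; exists v.
by case: q qn {uv}.
Qed.

(** A common node of [L] and [R] is a variable node, hence not the root of [L]. Its image is thus
    strictly below [u], and acyclicity forbids a way back. *)
Let images_below w : w \in images -> w \in nodes S /\ ~ reach S w u.
Proof.
move=> /imfsetP[v /= +->]; rewrite !inE => /andP[vR vL].
have [/(_ v vL)/subgraph_nodes[mvS _] mrt _] := mLS; split=> //.
have [q vq] := (tg_root (rg_lhs ruleLR).1).2 v vL.
have := morphism_walk mLS (rg_lhs ruleLR).1 vq; rewrite mrt; apply: below_not_reach.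
move=> eq; rewrite eq /= in vq; have [x [xv _]] := rg_common ruleLR vL vR.
by apply: (rg_root ruleLR); exists x; rewrite vq.
Qed.

Let rhs_not_in_S w : w \in nodes R -> w \notin nodes S.
Proof. by move=> wR; apply: (fdisjointP fresh); rewrite inE wR orbT. Qed.

Let in_images w : (w \in domf (gr S).[& images]) = (w \in images).
Proof.
by rewrite mem_restrictf andb_idr // => /images_below[].
Qed.

Let fnd_rhs w : w \in nodes R -> w \notin nodes L ->
  G.[? w] = omap (fun a => (a.1, map mbar a.2)) (gr R).[? w].
Proof.
move=> wR wL; have wI : w \notin images.
  by apply: contra (rhs_not_in_S wR) => /images_below[].
rewrite /G fnd_cat mem_catf in_images (negPf wI) orbF.
have -> : w \in domf (map_succ mbar (gr R).[\ nodes L]) by rewrite /= mem_remf wL.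
by rewrite fnd_cat in_images (negPf wI) map_succ_fnd fnd_rem (negPf wL).
Qed.

(** An image of a common node enters the union from the right operand, without redirection; this
    agrees with the redirected entry because [u] is not among its successors. *)
Let fnd_host w : w \in nodes S -> w <> u ->
  G.[? w] = omap (fun a => (a.1, map redirect a.2)) (gr S).[? w].
Proof.
move=> wS /eqP wu; rewrite /G fnd_cat mem_catf in_images.
case: (boolP (w \in images)) => [wI|wI]; rewrite ?orbT ?orbF.
  rewrite fnd_cat in_images wI fnd_restrict wI in_fnd /=; congr Some.
  rewrite [LHS]surjective_pairing; congr pair; apply/esym/map_id_in => v wv.
  rewrite /redirect; case: eqP => // evu; have [_ []] := images_below wI.
  have /onthP[i wi] : u \in succ S w by rewrite /succ in_fnd -evu.
  exact: edge_reach wi.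
rewrite [_ \in _]mem_remf; case: (boolP (w \in domf (gr R))) => [/rhs_not_in_S/negP//|_].
by rewrite andbF map_succ_fnd fnd_rem1 wu.
Qed.

Let nodesG w : w \in domf G ->
  (w \in nodes S /\ w <> u) \/ (w \in nodes R /\ w \notin nodes L).
Proof.
rewrite /G !mem_catf in_images => /or3P[|| /images_below[wS wu]].
- by rewrite [_ \in _]mem_remf1 => /andP[/eqP wu wS]; left.
- by rewrite [_ \in _]mem_remf => /andP[wL wR]; right.
- by left; split=> // ewu; apply: wu; rewrite ewu; apply: reach_refl.
Qed.

Let lab_host w : w \in nodes S -> w <> u -> lab G w = lab S w.
Proof. by move=> wS wu; rewrite /lab fnd_host //; case: (_.[? _]). Qed.

Let succ_host w : w \in nodes S -> w <> u -> succ G w = map redirect (succ S w).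
Proof. by move=> wS wu; rewrite /succ fnd_host //; case: (_.[? _]). Qed.

Let lab_rhs w : w \in nodes R -> w \notin nodes L -> lab G w = lab R w.
Proof. by move=> wR wL; rewrite /lab fnd_rhs //; case: (_.[? _]). Qed.

Let succ_rhs w : w \in nodes R -> w \notin nodes L -> succ G w = map mbar (succ R w).
Proof. by move=> wR wL; rewrite /succ fnd_rhs //; case: (_.[? _]). Qed.

Let wfG : wf_labels G.
Proof.
split=> w a wa; have [[wS wu]|[wR wL]] := nodesG (lab_nodes wa); move: wa.
- by rewrite lab_host // succ_host // size_map; apply: tg_fun.
- by rewrite lab_rhs // succ_rhs // size_map; apply: tg_fun (rg_rhs ruleLR).1 _ _.
- by rewrite lab_host // succ_host // => /(tg_var tgS) ->.
- by rewrite lab_rhs // succ_rhs // => /(tg_var (rg_rhs ruleLR).1) ->.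
Qed.

Let rep_host w t : ~ reach S w u -> rep S w t -> rep G w t.
Proof.
elim/nested_term_ind: t w => [x|f ts IH] w wu tw; have wS := rep_nodes tw;
  have nwu : w <> u by move=> e; apply: wu; rewrite e; apply: reach_refl.
  by rewrite /= lab_host.
case: tw => wf sub; rewrite /= lab_host //; split=> // i.
have [v [wv tv]] := sub i.
have vu : ~ reach S v u by move=> vu; apply: wu; apply: reach_trans (edge_reach wv) vu.
exists v; split; last exact: IH.
rewrite /edge succ_host // onth_map wv /= /redirect; case: eqP => // evu.
by case: vu; rewrite evu; apply: reach_refl.
Qed.

Let rep_rhs sigma w t : (forall w l', rep L w l' -> rep S (m w) (subst sigma l')) ->
  rep R w t -> rep G (mbar w) (subst sigma t).
Proof.
move=> sigmaP; elim/nested_term_ind: t w => [x|f ts IH] w tw; have wR := rep_nodes tw.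
  have wL : w \in nodes L by apply: (rg_var ruleLR); exists x.
  have [y [wyL]] := rg_common ruleLR wL wR; rewrite (tw : lab R w = _) => -[exy].
  rewrite /mbar wL; apply: rep_host; last by apply: sigmaP; rewrite exy.
  by have [] := @images_below (m w); first by apply: in_imfset; rewrite /= inE wR wL.
have [wf sub] := tw; have wL : w \notin nodes L.
  by apply/negP => wL; have [y [_]] := rg_common ruleLR wL wR; rewrite wf.
rewrite /mbar (negPf wL) /= lab_rhs //; split=> // i.
have [v [wv tv]] := sub i; exists (mbar v); rewrite ffunE; split; last exact: IH.
by rewrite /edge succ_rhs // onth_map wv.
Qed.

(** Induction along the path [q]. Its uniqueness keeps the arguments off the path unchanged: from
    none of them can [u] be reached. *)
Let rep_replace sigma q w t : (forall w l', rep L w l' -> rep S (m w) (subst sigma l')) ->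
  rep S w t -> walk S w q u -> (forall q', walk S w q' u -> q' = q) ->
  rep G (redirect w) (replace_at t q (subst sigma r)).
Proof.
move=> sigmaP; elim: q w t => [|i q IH] w t tw.
  move=> -> _; rewrite /redirect eqxx (_ : replace_at _ _ _ = subst sigma r); last by case: (t).
  exact: rep_rhs sigmaP (rg_rhs ruleLR).2.
move=> [v [wv vu]] uniq_q; have wS := edge_nodes wv.
have wu : w <> u by move=> e; have := uniq_q [::] e.
case: t tw => [x wx|f ts [wf sub]].
  by move: wv; rewrite /edge (tg_var tgS wx) onth0n.
rewrite /redirect; case: eqP => // _ /=; rewrite lab_host //; split=> // j.
have [y [wy ty]] := sub j; exists (redirect y).
rewrite /edge succ_host // onth_map wy ffunE; split=> //.
case: eqP => [ej|nej].
  move: wy; rewrite /edge ej wv => -[evy]; rewrite -evy in ty *; apply: IH => // q' vq'.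
  by have [] : i :: q' = i :: q by apply: uniq_q; exists v.
have yu : ~ reach S y u.
  move=> [q' yq']; apply: nej.
  by have [] : (j : nat) :: q' = i :: q by apply: uniq_q; exists y.
rewrite /redirect; case: eqP => [e|_]; last exact: rep_host.
by case: yu; rewrite e; apply: reach_refl.
Qed.

Lemma replace_node_correct : exists sigma, subterm_at s p = Some (subst sigma l) /\
  graph_of (replace_at s p (subst sigma r)) (replace_node S u (instantiate L R m S)).
Proof.
have [sigma sigmaP] := morphism_subst gS (rg_lhs ruleLR) mLS; exists sigma.
have wfS := term_graph_wf tgS; have [_ tS] := gS.
split.
  have [t' -> ut'] := rep_walk wfS tS up; congr Some; apply: rep_uniq ut' _.
  by have := sigmaP _ _ (rg_lhs ruleLR).2; have [_ -> _] := mLS.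
have GE : replace_node S u (instantiate L R m S) =
  subgraph (RootedGraph G (redirect (rt S))) (redirect (rt S)) by [].
rewrite GE; set T := subgraph _ _.
have tT : rep T (rt T) (replace_at s p (subst sigma r)).
  apply/rep_subgraph; first exact: reach_refl.
  apply: rep_replace => // q' /(posE _ _ tgS); exact: (u_at_p q').1.
split=> //; apply: term_graphI tT _ _.
- by split=> w a wa; have /subgraph_nodes[_ rw] := lab_nodes wa; move: wa;
    rewrite subgraph_lab // subgraph_succ //; [apply: wfG.1 | apply: wfG.2].
- move=> w /subgraph_nodes[_ [q wq]]; exists q; apply/subgraph_walk => //.
  exact: reach_refl.
(* Variable nodes of [R] lie in [L] and enter the result through their images, so every variable
   label comes from [S]. *)
- have hostvar w x : lab T w = Some (inr x) -> lab S w = Some (inr x).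
    move=> wx; have /subgraph_nodes[wG rw] := lab_nodes wx; move: wx.
    rewrite subgraph_lab //=; have [[wS wu]|[wR /negP wL]] := nodesG wG.
      by rewrite lab_host.
    rewrite lab_rhs; [|by []|exact/negP] => wx; case: wL.
    by apply: (rg_var ruleLR); exists x.
  by move=> a b x /hostvar xa /hostvar xb; apply: (tg_var_unique tgS xa xb).
Qed.

End GraphRewrite.


(** * Matching in a graph that is maximally shared strictly below a position *)

Lemma matching_morphism t l S L u p sigma : graph_of t S -> graph_of l L ->
    ~ (exists T, fold_step ar p S T) ->
    walk S (rt S) p u -> rep S u (subst sigma l) ->
  exists m, morphism m L (subgraph S u).
Proof.
move=> gS [tgL lL] nf pu ul; have [tgS tS] := gS.
(* The morphism sends [w] to the node at the same position below [u]; when [w]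
   has several positions, they all lead to one node by [fold_normal_shared]. *)
pose same_pos w v := exists q, walk L (rt L) q w /\ walk S u q v.
have same_pos_ex w : w \in nodes L -> exists v, same_pos w v.
  move=> wL; have [q qw] := (tg_root tgL).2 w wL.
  have [l' /(subterm_at_subst sigma) e _] := rep_walk (term_graph_wf tgL) lL qw.
  by have [v qv _] := walk_rep ul e; exists v, q.
have same_pos_rep w v l' : same_pos w v -> rep L w l' -> rep S v (subst sigma l').
  move=> [q [qw qv]] wl'.
  have [l'' /(subterm_at_subst sigma) e wl''] := rep_walk (term_graph_wf tgL) lL qw.
  have [v' qv' v'l''] := walk_rep ul e.
  by rewrite (walk_det qv qv') (rep_uniq wl' wl'').
have below q v : q <> [::] -> walk S u q v -> strictly_below S p v.
  move=> qn qv; exists (p ++ q); split; first by apply/posE => //; apply/walk_cat; exists u.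
  rewrite /proper_prefix prefix_prefix -{1}[p]cats0 eqseq_cat // eqxx /=.
  by case: q qn {qv}.
have same_pos_uniq w v v' : same_pos w v -> same_pos w v' -> v = v'.
  move=> wv wv'; have [q [qw qv]] := wv; have [q' [qw' qv']] := wv'.
  have [l' _ wl'] := rep_walk (term_graph_wf tgL) lL qw.
  (* By acyclicity of [L], both positions are empty or neither is; in the latter case both nodes are
     strictly below [p]. *)
  have nilE : q = [::] <-> q' = [::].
    by split=> e; [move: qw qw' | move: qw' qw]; rewrite e /= => <-; apply: tg_acyclic tgL _ _.
  have [e|qn] := pselect (q = [::]).
    by move: qv qv'; rewrite (nilE.1 e) e /= => <-.
  apply: (fold_normal_shared gS nf (below q v qn qv))
    (same_pos_rep _ _ _ wv wl') (same_pos_rep _ _ _ wv' wl').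
  by apply: below qv' => /nilE.
have /choice[m mP] w : exists v, w \in nodes L -> same_pos w v.
  by case: (boolP (w \in nodes L)) => [/same_pos_ex[v wv]|_]; [exists v | exists w].
have uS := rep_nodes ul.
exists m; split=> [w /mP[q [_ qv]]||w f wf].
- by apply/subgraph_nodes; split; [apply: walk_nodes qv | exists q].
- by apply: same_pos_uniq (mP _ (tg_root tgL).1) _; exists [::].
have wL := lab_nodes wf; have wmw := mP w wL; have [q [qw qv]] := wmw.
have [l' lq wl'] := rep_walk (term_graph_wf tgL) lL qw.
have vl' := same_pos_rep _ _ _ wmw wl'.
rewrite /preserves subgraph_lab ?subgraph_succ; try by exists q.
case: l' {lq} wl' vl' => [x|g ts]; first by rewrite /= wf.
case; rewrite wf => -[efg]; rewrite -{}efg in ts *; move=> subL [vf subS]; split=> //.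
have sw := tg_fun tgL wf; have sv := tg_fun tgS vf.
apply: eq_from_onth => i; rewrite onth_map; case: (ltnP i (ar f)) => le_i; last first.
  by rewrite !onth_default // ?sw ?sv.
have [w1 [ww1 _]] := subL (Ordinal le_i); have [v1 [vv1 _]] := subS (Ordinal le_i).
rewrite -[onth _ i]/(onth _ (Ordinal le_i)) vv1.
rewrite -[onth (succ L w) i]/(onth _ (Ordinal le_i)) ww1 /=; congr Some.
have w1L := tg_closed tgL wL (edge_mem ww1).
(* Both [m w1] and [v1] share a position with [w1], the latter by extending [q] with [i]. *)
by apply: same_pos_uniq (mP w1 w1L); exists (rcons q i); split; apply/walk_rcons;
  [exists w | exists (m w)].
Qed.

(** * Fresh copies of rules *)

Lemma fresh_injection (A B : {fset N}) : exists rho : N -> N,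
  {in A &, injective rho} /\ forall x, x \in A -> rho x \notin B.
Proof.
suff [rho [inj rhoB]] : exists rho : N -> N, {in enum_fset A &, injective rho} /\
    forall x, x \in enum_fset A -> rho x \notin B by exists rho.
elim: (enum_fset A) => [|a s [rho [inj rhoB]]]; first by exists id.
(* The new value lies above [B] and all earlier values, so it avoids [B] and preserves
   injectivity. *)
have [n _ above] := node_above a (B `|` [fset rho x | x in s]).
have nB : n \notin B.
  by apply/negP => nB; have := above n; rewrite inE nB ltxx => /(_ isT).
have nrho x : x \in s -> n <> rho x.
  move=> xs e; have := above n; rewrite inE ltxx {2}e in_imfset ?orbT //.
  by move=> /(_ isT).
exists (fun x => if x == a then n else rho x); split=> [x y|x]; rewrite !inE.
  case: eqP => [->|_] /=; case: eqP => [->|_] //= xs ys; first by move/(nrho y ys).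
    by move/esym/(nrho x xs).
  exact: inj.
by case: eqP => //= _ /rhoB.
Qed.

Lemma renaming_exists rho S : {in nodes S &, injective rho} -> rt S \in nodes S ->
  exists T, renaming_of rho S T.
Proof.
move=> inj rtS; pose rename (a : (F + V) * seq N) := (a.1, map rho a.2).
have /choice[c cP] y : exists a, forall x, x \in nodes S -> rho x = y ->
    omap rename (gr S).[? x] = Some a.
  have [[x xS xy]|nex] := pselect (exists2 x, x \in nodes S & rho x = y).
    exists (rename (gr S).[xS]) => x' x'S x'y.
    by rewrite (inj x' x) ?x'y // in_fnd.
  (* Outside the image of [rho] the entry of the root serves as an arbitrary default. *)
  by exists (rename (gr S).[rtS]) => x xS xy; case: nex; exists x.
pose H : graph := [fmap y : rho @` nodes S => c (val y)].
exists (RootedGraph H (rho (rt S))); split=> // x xS.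
have rx : rho x \in domf H by apply: in_imfset.
have Hx : H.[? rho x] = Some (c (rho x)) by rewrite in_fnd ffunE.
rewrite /preserves /lab /succ /= Hx -(cP _ x xS erefl).
by rewrite in_fnd.
Qed.

Lemma fresh_copy (g : grule F V N) (B : {fset N}) : is_grule ar g -> exists L R : rooted_graph,
  isomorphic_copy g (L, R) /\ [disjoint nodes L `|` nodes R & B].
Proof.
case: g => L R [tgL tgR _ _].
have [rho [inj rhoB]] := fresh_injection (nodes L `|` nodes R) B.
have [||L' renL] := @renaming_exists rho L; [|exact: (tg_root tgL).1|].
  by move=> x y xL yL; apply: inj; rewrite inE ?xL ?yL.
have [||R' renR] := @renaming_exists rho R; [|exact: (tg_root tgR).1|].
  by move=> x y xR yR; apply: inj; rewrite inE ?xR ?yR orbT.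
exists L', R'; split; first by exists rho.
have [-> _ _] := renL; have [-> _ _] := renR.
apply/fdisjointP => y; rewrite inE => /orP[] /imfsetP[x /= xN ->];
  by apply: rhoB; rewrite inE xN ?orbT.
Qed.

End GraphTheory.

(** * Adequacy of graph rewriting for term rewriting *)

Theorem theorem22
  (F : finType) (ar : F -> nat) (hF : exists c : F, ar c = 0)
  (V : countType) (hV : forall X : seq V, exists x : V, x \notin X)
  (disp : Order.disp_t) (N : orderType disp)
  (hN : forall v : N, exists u : N, (v < u)%O)
  (Rs : trs ar V) (hRs : is_trs Rs)
  (Gs : grs F V N) (hGs : simulating Rs Gs)
  (s : term ar V) (p : position)
  (S : rooted_graph F V N) (hS : is_term_graph ar S) (hSs : represents S s)
  (t : term ar V) :
  rewrites Rs p s t <->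
  exists T : rooted_graph F V N,
    [/\ is_term_graph ar T,
        represents T t
      & rel_comp (normalizes (unfold_step ar p))
          (rel_comp (normalizes (fold_step ar p)) (grewrites Gs p)) S T].
Proof.
have gS : graph_of s S by split=> //; apply/represents_rep.
have unfold_inv (A B : rooted_graph F V N) :
    graph_of s A -> normalizes (unfold_step ar p) A B -> graph_of s B.
  by apply: normalizes_inv => X Y gX /(unfold_step_graph_of gX)[].
have fold_inv (A B : rooted_graph F V N) :
    graph_of s A -> normalizes (fold_step ar p) A B -> graph_of s B.
  by apply: normalizes_inv => X Y gX /(fold_step_graph_of gX)[].
split=> [[l [r [sigma [lrRs sp ->]]]]|[T [tgT /represents_rep tT]]].
  have [S1 S_S1] := unfold_normalizes_exists p gS; have gS1 := unfold_inv _ _ gS S_S1.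
  have [S2 S1_S2] := fold_normalizes_exists p gS1; have gS2 := fold_inv _ _ gS1 S1_S2.
  have [lNvar rl] := hRs l r lrRs.
  (* A left-hand side is no variable, so the subterm at [p] is an application, as [normal_unshared]
     requires. *)
  have [u pu] : exists u, unshared_at S2 u p.
    case: l lNvar {lrRs rl} sp => [x /(_ x)//|f ts] _ /= sp.
    exact: (normal_unshared hN gS S_S1 S1_S2 sp).
  have [tgS2 sS2] := gS2.
  have posu : pos S2 u p by apply/pu.
  have walk_u := (posE _ _ tgS2).1 posu.
  have ul : rep S2 u (subst sigma l).
    have [t' e ut'] := rep_walk (term_graph_wf tgS2) sS2 walk_u.
    by move: e; rewrite sp => -[->].
  have [g [gGs simg]] := hGs.1 _ lrRs.
  have gg : is_grule ar g by case: g simg {gGs} => L R [].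
  have [L [R [iso dis]]] := fresh_copy hN (nodes S2) gg.
  have ruleLR := isomorphic_copy_rule_graphs simg iso.
  have [m mLS] := matching_morphism gS2 (rg_lhs ruleLR) S1_S2.2 walk_u ul.
  have [sigma' [sp' [tgT tT]]] := replace_node_correct gS2 pu ruleLR dis mLS.
  exists (replace_node S2 u (instantiate L R m S2)); split=> //.
    (* The substitution [sigma'] read off from the morphism agrees with [sigma] on the variables of
       [l], hence on those of [r]. *)
    apply/represents_rep; rewrite (_ : subst sigma r = subst sigma' r) //.
    have [el] : Some (subst sigma l) = Some (subst sigma' l) by rewrite -sp -sp'.
    by apply/subst_eq_in => x /rl; apply: (subst_eq_in _ _ _).1 el x.
  exists S1; split=> //; exists S2; split=> //.
  by exists u, g, L, R, m; split.
move=> [S1 [S_S1 [S2 [S1_S2 [u [g [L [R [m [posu [gGs iso] dis mLS eT]]]]]]]]]].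
have gS1 := unfold_inv _ _ gS S_S1; have gS2 := fold_inv _ _ gS1 S1_S2.
have [[l r] [lrRs simg]] := hGs.2 g gGs.
have ruleLR := isomorphic_copy_rule_graphs simg iso.
have [tgS2 sS2] := gS2; have walk_u := (posE _ _ tgS2).1 posu.
(* Here the morphism shows that the subterm at [p] is an instance of [l], hence an application. *)
have pu : unshared_at S2 u p.
  have [sigma sigmaP] := morphism_subst gS2 (rg_lhs ruleLR) mLS.
  have [t' sp ut'] := rep_walk (term_graph_wf tgS2) sS2 walk_u.
  have ul : rep S2 u (subst sigma l).
    by have := sigmaP _ _ (rg_lhs ruleLR).2; have [_ -> _] := mLS.
  move: sp; rewrite (rep_uniq ut' ul).
  have [lNvar _] := hRs l r lrRs.
  case: l {lrRs simg ruleLR sigmaP ul} lNvar => [x /(_ x)//|f ts] _ /= sp.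
  have [v pv] := normal_unshared hN gS S_S1 S1_S2 sp.
  suff -> : u = v by [].
  exact: walk_det walk_u ((posE _ _ tgS2).1 ((pv p).2 erefl)).
have [sigma [sp [_ tT']]] := replace_node_correct gS2 pu ruleLR dis mLS.
exists l, r, sigma; split=> //.
by apply: rep_uniq tT _; rewrite eT.
Qed.
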